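(* Let $G$ be a connected graph with $v(G)>1$ vertices. Let $s$ be the number of vertices of $G$ whose degree is $1$ or $3$, and let $t$ be the number of vertices of $G$ whose degree is at least $4$. Then $$u(G)\ge \frac{1}{3}\,t+\frac{1}{4}\,s+\frac{3}{2}.$$
   Context: Graphs are finite, undirected, without loops and multiple edges; $v(G)$ is the number of vertices of $G$. For a connected graph $G$, $u(G)$ denotes the maximal number of leaves (vertices of degree $1$ in the tree) in a spanning tree of $G$. *)

(* Defs.v *)
From mathcomp Require Import all_boot all_order all_algebra.

Set Implicit Arguments.
Unset Strict Implicit.
Unset Printing Implicit Defensive.

(* A finite simple graph is a finType T of vertices with a
   symmetric and irreflexive adjacency relation e : rel T. *)

Section Graphs.
Variable T : finType.
Implicit Types (e : rel T) (F : {set T * T}).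

Definition simple_graph e : Prop := symmetric e /\ irreflexive e.

Definition connected e : bool := [forall x, forall y, connect e x y].

Definition degree e (x : T) : nat := #|[set y | e x y]|.

(* A cycle is a closed walk through at least 3 pairwise distinct vertices.
   Bounding its length by #|T| loses nothing (see acyclicP) and makes the
   property boolean, so that one can take a maximum over spanning trees. *)
Definition acyclic e : bool :=
  [forall n : 'I_#|T|.+1, (2 < n) ==>
     ~~ [exists c : n.-tuple T, ucycleb e c]].

Lemma acyclicP e :
  reflect (forall c : seq T, 2 < size c -> ~ ucycle e c) (acyclic e).
Proof.
apply: (iffP forallP) => [ac c c2 cyc | ac n].
  have /andP[_ uc] : ucycleb e c by [].
  have sc : size c < #|T|.+1 by rewrite ltnS -(card_uniqP uc) max_card.
  have /implyP/(_ c2)/existsP[] := ac (Ordinal sc).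
  by exists (in_tuple c).
apply/implyP => n2; apply/existsP => -[c cyc].
by apply: (ac c); rewrite ?size_tuple.
Qed.

Definition tree e : bool := connected e && acyclic e.

Definition leaves e : {set T} := [set x | degree e x == 1].

(* A spanning subgraph is given by its set F of edges, each edge being
   recorded in both directions. *)
Definition adj F : rel T := [rel x y | (x, y) \in F].

Definition spanning_tree e F : bool :=
  [&& [forall x, forall y, adj F x y == adj F y x],
      [forall x, forall y, adj F x y ==> e x y]
    & tree (adj F)].

Definition max_leaves e : nat :=
  \max_(F : {set T * T} | spanning_tree e F) #|leaves (adj F)|.

End Graphs.

(* Main.v *)
Require Import Defs.
From mathcomp Require Import all_boot all_order all_algebra.
From mathcomp Require Import zify lra.
Import Order.TTheory GRing.Theory Num.Theory.
Local Open Scope ring_scope.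

(** Multiply the inequality by 12: a vertex [x] weighs [wt x], which is 3 for
degree 1 or 3, 4 for degree at least 4 and 0 for degree 2, and a spanning tree
is sought with [12 * (number of leaves) >= total weight + 18].

A tree is grown from a root [p] by expansions: to expand a leaf is to attach to
it all of its neighbours outside the tree.  The set [I] of expanded vertices
determines everything that matters: the tree covers [reach I], which is [p]
and the closed neighbourhood of [I], and its leaves are [fringe I].  A leaf is
dead when it has no neighbour outside the tree.  Progress is measured by
<<
   pot I = 9 * (leaves) + 3 * (dead leaves) - weight of the covered vertices,
>>
which becomes [12 * (leaves) - total weight] once the tree is spanning, since
then every leaf is dead.

The core is [grow_step]: as long as the tree does not span, some expansions in
a row do not decrease [pot].  Expanding a leaf with [k >= 2] outside neighbours
gains at least [9 * (k - 1) - 4 * k > 0].  Otherwise every leaf has at most one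
outside neighbour; take an outside neighbour [y] of a leaf, with [m] neighbours
in the tree.  Attaching [y] kills [m - 1] other leaves, and this pays for [y],
possibly after expanding [y] too, except when [m = 1] and [y] has degree 3.  In
that case ([cubic_step]) expanding [y] to its two other neighbours [z1], [z2]
loses at most 2, and this loss is recovered by a killed leaf or by one or two
more expansions around the [z]'s.

What remains is the additive constant.  If there is a pendant vertex, it serves
as root: it is a leaf of the final tree although it has been expanded, and
this is worth 12.  If there is none, the root is a vertex of maximal degree,
expanded at once, and 3 more units come from the last expansion, whose new
leaves are all dead; the term [bonus] of [pot] books these units in advance. *)

(** * Neighbourhoods and weights *)

Section Growth.

Set Implicit Arguments.
Unset Strict Implicit.
Unset Printing Implicit Defensive.

Local Open Scope nat_scope.

Variables (T : finType) (e : rel T) (p : T).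
Implicit Types (I D A B : {set T}) (v x y z : T).

Definition nb x : {set T} := [set y | e x y].

Lemma in_nb x y : (y \in nb x) = e x y.
Proof. by rewrite inE. Qed.

Definition wt x : nat :=
  if (degree e x == 1) || (degree e x == 3) then 3
  else if 4 <= degree e x then 4 else 0.

Definition weight A := \sum_(x in A) wt x.

Lemma wt_le4 x : wt x <= 4.
Proof. by rewrite /wt; case: ifP => // _; case: ifP. Qed.

Lemma wt_deg3 x : degree e x <= 3 -> wt x <= 3.
Proof. by rewrite /wt; case: ifP => // _; case: leqP => //; lia. Qed.

Lemma wt_heavy x : 3 < wt x -> 4 <= degree e x.
Proof. by rewrite /wt; case: ifP => // _; case: ifP. Qed.

Lemma weight_le4 A : weight A <= 4 * #|A|.
Proof.
by rewrite mulnC -sum_nat_const; apply: leq_sum => x _; apply: wt_le4.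
Qed.

Lemma weightT : weight setT =
  3 * #|[set x : T | (degree e x == 1) || (degree e x == 3)]| +
  4 * #|[set x : T | 4 <= degree e x]|.
Proof.
rewrite /weight -!sum1_card !big_distrr /= big_mkcond.
rewrite [X in _ = X + _]big_mkcond [X in _ = _ + X]big_mkcond -big_split.
apply: eq_bigr => x _; rewrite !inE /wt /=.
by case: ifP => [/orP[]/eqP->|_] //; case: ifP.
Qed.

Lemma weightU A B : [disjoint A & B] -> weight (A :|: B) = weight A + weight B.
Proof. by move=> dAB; rewrite /weight -bigU //; apply: eq_bigl => x; rewrite inE. Qed.

Lemma weight1 x : weight [set x] = wt x.
Proof. exact: big_set1. Qed.

Lemma weight2_le x y : weight [set x; y] <= wt x + wt y.
Proof.
rewrite /weight; case: (eqVneq x y) => [->|nxy].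
  by rewrite setUid big_set1 leq_addr.
by rewrite big_setU1 ?inE //= big_set1.
Qed.

(** * Growing a tree by expansions *)

Definition reach I : {set T} :=
  [set x | [|| x == p, x \in I | [exists y in I, e y x]]].

Definition fringe I := reach I :\: I.

Definition fresh v I := nb v :\: reach I.

Definition dead I := [set x in fringe I | nb x \subset reach I].

Definition pendant_free := [forall x, degree e x != 1].

(** The 3 units that the last expansion brings by killing its own new leaves,
granted as long as the tree does not span.  They are not available when that
last expansion attaches a pendant vertex, whose own death pays for its weight,
hence the restriction to graphs without pendant vertices. *)
Definition bonus I : nat := pendant_free && (reach I != setT).

Definition pot I : int :=
  (9 * #|fringe I|%:Z + 3 * (#|dead I| + bonus I)%:Z - (weight (reach I))%:Z)%R.

Lemma in_reach I x :
  (x \in reach I) = [|| x == p, x \in I | [exists y in I, e y x]].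
Proof. by rewrite inE. Qed.

Lemma sub_reach I : I \subset reach I.
Proof. by apply/subsetP => x xI; rewrite inE xI orbT. Qed.

Lemma nb_reach I x y : x \in I -> e x y -> y \in reach I.
Proof.
by move=> xI exy; rewrite inE; apply/or3P/Or33/existsP; exists x; rewrite xI.
Qed.

Lemma fringeP I x y : x \in reach I -> y \notin reach I -> e x y ->
  x \in fringe I.
Proof.
move=> xR yR exy; rewrite inE xR andbT; apply: contra yR => xI.
exact: nb_reach exy.
Qed.

Lemma reach_expand I v : v \in fringe I ->
  reach (v |: I) = reach I :|: fresh v I.
Proof.
move=> /setDP[vR vI]; apply/setP => x.
apply/idP/idP.
  rewrite in_reach => /or3P[/eqP->|/setU1P[->|xI]|].
  - by rewrite !inE eqxx.
  - by rewrite inE vR.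
  - by rewrite inE (subsetP (sub_reach I) _ xI).
  case/existsP => y /andP[/setU1P[->|yI] eyx].
    by rewrite !in_setU in_setD in_nb eyx andbT orbN.
  by rewrite inE (nb_reach yI eyx).
case/setUP => [|/setDP[]].
  rewrite in_reach => /or3P[/eqP->|xI|].
  - by rewrite inE eqxx.
  - by rewrite (subsetP (sub_reach _)) // setU1r.
  case/existsP => y /andP[yI eyx].
  by apply: nb_reach eyx; rewrite setU1r.
by rewrite in_nb => evx _; apply: nb_reach evx; rewrite setU11.
Qed.

Lemma disj_fresh I v : [disjoint reach I & fresh v I].
Proof. by rewrite disjoint_sym disjoints_subset /fresh setDE subsetIr. Qed.

Lemma fringe_expand I v : v \in fringe I ->
  fringe (v |: I) = (fringe I :\ v) :|: fresh v I.
Proof.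
move=> vF; rewrite /fringe reach_expand // /fresh; apply/setP => x.
rewrite !(in_setD, in_setU, in_set1).
have: (x == v) ==> (x \in reach I).
  by apply/implyP => /eqP->; case/setDP: vF.
have /implyP := subsetP (sub_reach I) x.
by case: (x == v); case: (x \in I); case: (x \in reach I); case: (x \in nb v).
Qed.

Lemma in_dead I x : (x \in dead I) = (x \in fringe I) && (nb x \subset reach I).
Proof. by rewrite inE. Qed.

Lemma dead_expand I v : v \in fringe I -> fresh v I != set0 ->
  dead I \subset dead (v |: I).
Proof.
move=> vF fr; apply/subsetP => x; rewrite !in_dead => /andP[xF nx].
rewrite fringe_expand // reach_expand //.
rewrite (subset_trans nx (subsetUl _ _)) andbT in_setU in_setD1 xF andbT.
case: eqP => // xv; move: fr; rewrite -xv /fresh.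
by move: nx; rewrite -setD_eq0 => ->.
Qed.

(** The balance of one expansion in which the leaves in [D] are known to die.
Without pendant vertices [D] has to consist of old leaves, because the death of
the new ones at the last expansion is what replaces the bonus that is lost. *)
Lemma expand_gain I v D : v \in fringe I -> fresh v I != set0 ->
  D \subset dead (v |: I) :\: dead I -> (pendant_free -> D \subset reach I) ->
  (pot I + 9 * #|fresh v I|%:Z + 3 * #|D|%:Z
     <= pot (v |: I) + 9 + (weight (fresh v I))%:Z)%R.
Proof.
move=> vF fr sD pD.
have cF : #|fringe (v |: I)| + 1 = #|fringe I| + #|fresh v I|.
  rewrite fringe_expand // cardsU disjoint_setI0 ?cards0 ?subn0.
    by rewrite (cardsD1 v (fringe I)) vF; lia.
  apply: disjointWl (disj_fresh I v).
  by apply: subset_trans (subsetDl _ _) (subsetDl _ _).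
have cW : weight (reach (v |: I)) = weight (reach I) + weight (fresh v I).
  by rewrite reach_expand // weightU // disj_fresh.
have cD : #|dead I| + #|D| + bonus I <= #|dead (v |: I)| + bonus (v |: I).
  have sID : dead I :|: D \subset dead (v |: I).
    rewrite subUset dead_expand //=; apply: subset_trans sD _.
    exact: subsetDl.
  have dID : [disjoint dead I & D].
    rewrite disjoint_sym disjoints_subset.
    by apply: subset_trans sD _; rewrite setDE subsetIr.
  have cID : #|dead I :|: D| = #|dead I| + #|D|.
    by rewrite cardsU disjoint_setI0 ?cards0 ?subn0.
  rewrite /bonus -cID.
  have [nR|] := eqVneq (reach (v |: I)) setT; last first.
    move=> _; have := subset_leq_card sID.
    by case: pendant_free; clear; rewrite /=; lia.
  have [pf|_] := boolP pendant_free; last by rewrite !addn0 subset_leq_card.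
  rewrite andbF addn0 /=; apply: (@leq_trans #|dead I :|: D :|: fresh v I|).
    rewrite (cardsU _ (fresh v I)) disjoint_setI0 ?cards0 ?subn0.
      by rewrite leq_add2l; case: (_ != _); rewrite ?card_gt0.
    apply: disjointWl (disj_fresh I v).
    rewrite subUset pD // andbT; apply/subsetP => x.
    by rewrite inE => /andP[/setDP[]].
  apply: subset_leq_card; rewrite subUset sID /=; apply/subsetP => x xf.
  by rewrite in_dead nR subsetT andbT fringe_expand // inE xf orbT.
rewrite /pot; lia.
Qed.

Lemma expand_gain0 I v : v \in fringe I -> fresh v I != set0 ->
  (pot I + 9 * #|fresh v I|%:Z <= pot (v |: I) + 9 + (weight (fresh v I))%:Z)%R.
Proof.
move=> vF fr.
by have := @expand_gain I v set0 vF fr (sub0set _) (fun=> sub0set _);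
  rewrite cards0; lia.
Qed.

Lemma expand_gain1 I v x : v \in fringe I -> fresh v I != set0 ->
  x \in fringe I -> x != v -> fresh x I != set0 ->
  fresh x I \subset fresh v I ->
  (pot I + 9 * #|fresh v I|%:Z + 3
     <= pot (v |: I) + 9 + (weight (fresh v I))%:Z)%R.
Proof.
move=> vF fr xF xv fx sx.
have := @expand_gain I v [set x] vF fr; rewrite cards1 mulr1; apply.
  rewrite sub1set inE in_dead xF -setD_eq0 fx in_dead /=.
  rewrite fringe_expand // in_setU in_setD1 xv xF /= reach_expand //.
  by rewrite -subDset.
by rewrite sub1set; case/setDP: xF.
Qed.

(** Since [9 * (k - 1) - 4 * k = 5 * k - 9], this is a strict gain. *)
Lemma expand_gain2 I v : v \in fringe I -> 1 < #|fresh v I| ->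
  (pot I + 5 * #|fresh v I|%:Z <= pot (v |: I) + 9)%R.
Proof.
move=> vF fr; have := @expand_gain0 I v vF; rewrite -card_gt0.
by have := weight_le4 (fresh v I); lia.
Qed.

(** * Improving a tree that does not span *)

Inductive grown : {set T} -> Prop :=
| grown0 : grown set0
| grownS I v : grown I -> v \in fringe I -> grown (v |: I).

Definition improvable I : Prop :=
  exists J, [/\ grown J, #|I| < #|J| & (pot I <= pot J)%R].

Lemma card_expand I v : v \in fringe I -> #|v |: I| = #|I|.+1.
Proof. by case/setDP => _ vI; rewrite cardsU1 vI. Qed.

Lemma fringe_keep I v x : v \in fringe I -> x \in fringe I -> x != v ->
  x \in fringe (v |: I).
Proof. by move=> vF xF xv; rewrite fringe_expand // in_setU in_setD1 xv xF. Qed.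

Lemma fringe_fresh I v x : v \in fringe I -> x \in fresh v I ->
  x \in fringe (v |: I).
Proof. by move=> vF xf; rewrite fringe_expand // in_setU xf orbT. Qed.

Lemma fresh_expand I v x : v \in fringe I ->
  fresh x (v |: I) = fresh x I :\: fresh v I.
Proof. by move=> vF; rewrite /fresh reach_expand // setDDl. Qed.

Lemma in_fresh I v x : (x \in fresh v I) = (x \notin reach I) && e v x.
Proof. by rewrite in_setD in_nb. Qed.

Definition tight I := forall x, x \in fringe I -> #|fresh x I| <= 1.

Lemma tight_fresh I x y : tight I -> x \in reach I -> y \notin reach I ->
  e x y -> x \in fringe I /\ fresh x I = [set y].
Proof.
move=> tI xR yR exy; have xF := fringeP xR yR exy; split=> //.
have yf : y \in fresh x I by rewrite in_fresh yR.
by apply/esym/eqP; rewrite eqEcard sub1set yf cards1 tI.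
Qed.

Lemma degree_split x A : degree e x = #|nb x :&: A| + #|nb x :\: A|.
Proof. by rewrite cardsID. Qed.

Lemma pot_spanning I : reach I = setT ->
  (pot I = 12 * #|~: I|%:Z - (weight setT)%:Z)%R.
Proof.
move=> RI; have fE : fringe I = ~: I by rewrite /fringe RI setTD.
have dE : dead I = ~: I.
  by apply/setP => x; rewrite in_dead fE RI subsetT andbT.
rewrite /pot dE fE /bonus RI eqxx andbF; lia.
Qed.

Lemma reach0 : reach set0 = [set p].
Proof.
apply/setP => x; rewrite in_reach !inE; case: eqP => //= _.
by apply/negbTE/exists_inPn => y; rewrite inE.
Qed.

Lemma root_fringe : p \in fringe set0.
Proof. by rewrite in_setD reach0 !inE eqxx. Qed.

Lemma grown_root I : grown I -> I != set0 -> p \in I.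
Proof.
elim=> [|J v gJ IH vF _]; first by rewrite eqxx.
have [J0|/IH pJ] := eqVneq J set0; last by rewrite setU1r.
suff -> : v = p by rewrite setU11.
case/setDP: vF; rewrite in_reach => /or3P[/eqP //|vJ|]; first by rewrite vJ.
by rewrite J0 => /exists_inP[x]; rewrite inE.
Qed.

Hypotheses (e_sym : symmetric e) (e_irr : irreflexive e).

Lemma fresh_root : fresh p set0 = nb p.
Proof.
rewrite /fresh reach0; apply/setP => x; rewrite !inE.
by case: eqVneq => [->|//]; rewrite e_irr.
Qed.

Lemma fresh_next I v y : v \in fringe I -> fresh v I = [set y] ->
  fresh y (v |: I) = nb y :\: reach I.
Proof.
move=> vF fv; rewrite fresh_expand // fv /fresh.
apply/setP => x; rewrite !inE.
by case: (eqVneq x y) => [->|//]; rewrite e_irr andbF.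
Qed.

(** The critical case: [v] is the only neighbour of the cubic vertex [y] in the
tree.  Expanding [v] and [y] attaches [y], [z1], [z2] for one more leaf, that
is, for a change of [9 - 3 - wt z1 - wt z2 >= -2].  An old leaf adjacent to
[z1] or [z2] dies, which gives 3.  Otherwise a [z] of weight 4 has at least
two outside neighbours, and three of them make its expansion gain 6.  Suppose
that [z1] has exactly two, and that one of the weights at stake being less than
4 does not already make up for the loss.  Either both are adjacent to [z2],
which then dies when [z1] is expanded, or one of them, [c], is not: then [c] is
adjacent to an old leaf, which dies, or [c] still has two outside neighbours,
and expanding [z1] and then [c] gains 1 twice. *)
Lemma cubic_step I v y : grown I -> tight I -> v \in reach I ->
  y \notin reach I -> e v y -> nb y :&: reach I = [set v] ->
  degree e y = 3 -> improvable I.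
Proof.
move=> gI tI vR yR evy nyI dy.
have [vF fv] := tight_fresh tI vR yR evy.
pose I1 := v |: I; have gI1 : grown I1 by apply: grownS.
have fv0 : fresh v I != set0 by rewrite fv -card_gt0 cards1.
have R1 : reach I1 = y |: reach I by rewrite reach_expand // fv setUC.
have yF1 : y \in fringe I1 by apply: fringe_fresh; rewrite ?fv ?set11.
have p1 : (pot I <= pot I1 + 3)%R.
  have := expand_gain0 vF fv0; rewrite fv cards1 weight1 -/I1.
  have : wt y <= 3 by rewrite wt_deg3 ?dy.
  clear; lia.
have fyE : fresh y I1 = nb y :\: reach I by apply: fresh_next.
have /eqP/cards2P[z1 [z2 [nz fy]]] : #|fresh y I1| = 2.
  by move: dy; rewrite fyE (degree_split y (reach I)) nyI cards1; clear; lia.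
have fy2 : #|fresh y I1| = 2 by rewrite fy cards2 nz.
have fy0 : fresh y I1 != set0 by rewrite -card_gt0 fy2.
pose I2 := y |: I1; have gI2 : grown I2 by apply: grownS.
have R2 : reach I2 = [set z1; z2] :|: (y |: reach I).
  by rewrite reach_expand // R1 fy setUC.
have c1 : #|I1| = #|I|.+1 by apply: card_expand.
have c2 : #|I2| = #|I|.+2 by rewrite card_expand // c1.
have p2 := expand_gain0 yF1 fy0; rewrite -/I2 fy2 in p2.
have wfy : weight (fresh y I1) <= wt z1 + wt z2 by rewrite fy weight2_le.
(* In a tight tree, the neighbours of [z] in the tree have [z] as their only
   outside neighbour, so that attaching [z] through another vertex kills them. *)
have oldF x z : x \in reach I -> z \notin reach I -> z != y -> e x z ->
    [/\ x \in fringe I1, x != y & fresh x I1 = [set z]].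
  move=> xR zR zy exz; have [xF fx] := tight_fresh tI xR zR exz.
  have xv : x != v.
    by apply: contra_neq zy => xv; apply/set1P; rewrite -fv -xv fx set11.
  split; first exact: fringe_keep.
    by apply: contraNneq yR => <-.
  rewrite fresh_expand // fx fv; apply/setP => u; rewrite !inE.
  by case: (eqVneq u z) => [->|_]; rewrite ?zy ?andbF.
have zP z : z \in [set z1; z2] -> [/\ z \notin reach I, z != y & e y z].
  rewrite -fy in_fresh R1 in_setU1 negb_or => /andP[/andP[zy zR] ez].
  by split.
have zF2 z : z \in [set z1; z2] -> z \in fringe I2.
  by rewrite -fy => zf; apply: fringe_fresh.
(* Only a total weight of 7 or 8 for [z1] and [z2] leaves a loss. *)
have [le6|gt6] := leqP (wt z1 + wt z2) 6.
  by exists I2; split; rewrite ?c2 //; clear -p1 p2 wfy le6; lia.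
have [/exists_inP[z zz /exists_inP[x xR exz]]|noadj] :=
    boolP [exists z in [set z1; z2], [exists x in reach I, e x z]].
  have [zR zy eyz] := zP z zz; have [xF1 xy fx1] := oldF _ _ xR zR zy exz.
  have := expand_gain1 yF1 fy0 xF1 xy; rewrite fx1 -card_gt0 cards1 sub1set.
  rewrite fy zz -fy fy2 => /(_ isT isT); rewrite -/I2 => p2'.
  exists I2; split; rewrite ?c2 //.
  by move: (wt_le4 z1) (wt_le4 z2); clear -p1 p2' wfy; lia.
have {}noadj z x : z \in [set z1; z2] -> x \in reach I -> ~~ e z x.
  move=> zz xR; apply: contra noadj => ezx; apply/exists_inP; exists z => //.
  by apply/exists_inP; exists x; rewrite // e_sym.
have {noadj} fresh_z z : z \in [set z1; z2] -> degree e z <= #|fresh z I2| + 2.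
  move=> zz; rewrite (degree_split z (reach I2)) addnC leq_add2l.
  have : nb z :&: reach I2 \subset [set y; if z == z1 then z2 else z1].
    apply/subsetP => x /setIP[]; rewrite in_nb R2 => ezx.
    case/setUP => [xz|/setU1P[->|xR]]; last 2 first.
    - by rewrite set21.
    - by move: (noadj _ _ zz xR); rewrite ezx.
    rewrite !inE orbC; apply/orP; left; move: zz xz ezx.
    have nz' : z2 != z1 by rewrite eq_sym.
    by case/set2P => -> /set2P[] ->; rewrite ?e_irr // ?(negPf nz') ?eqxx.
  move/subset_leq_card/leq_trans; apply.
  by rewrite cards2; case: (_ != _).
move: nz gt6 wfy R2 zP zF2 fresh_z fy.
wlog le21 : z1 z2 / wt z2 <= wt z1 => [IH|].
  case: (leqP (wt z2) (wt z1)) => [le21|/ltnW le12]; first exact: IH.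
  rewrite (setUC [set z1]) (addnC (wt z1)) eq_sym; exact: IH.
move=> nz gt6 wfy R2 zP zF2 fresh_z fy.
have w1 : wt z1 = 4 by move: (wt_le4 z1); clear -gt6 le21; lia.
have d1 : 4 <= degree e z1 by rewrite wt_heavy // w1.
have z1z : z1 \in [set z1; z2] by rewrite set21.
have z2z : z2 \in [set z1; z2] by rewrite set22.
have w2 := wt_le4 z2.
have [/exists_inP[z zz f3]|] :=
    boolP [exists z in [set z1; z2], 2 < #|fresh z I2|].
  have f1 : 1 < #|fresh z I2| by apply: leq_trans f3.
  exists (z |: I2); split; first by apply: grownS => //; apply: zF2.
    by rewrite card_expand ?zF2 // c2; clear; lia.
  by move: (expand_gain2 (zF2 _ zz) f1); clear -p1 p2 wfy w1 w2 f3; lia.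
rewrite negb_exists_in => /forall_inP f3.
have f1 : #|fresh z1 I2| = 2.
  by move: (f3 _ z1z) (fresh_z _ z1z); clear -d1; lia.
have f2 : #|fresh z2 I2| <= 2 by move: (f3 _ z2z); clear; lia.
have f10 : fresh z1 I2 != set0 by rewrite -card_gt0 f1.
have p3 := expand_gain0 (zF2 _ z1z) f10; rewrite f1 in p3.
pose I3 := z1 |: I2; have gI3 : grown I3 by apply: grownS => //; apply: zF2.
have c3 : #|I3| = #|I|.+3 by rewrite card_expand ?zF2 // c2.
rewrite -/I3 in p3.
(* The budget is [9 - 3] for [y] and its expansion plus 9 for that of [z1]; past
   it, [z1], [z2] and the two new vertices all have weight 4. *)
have [le15|gt15] := leqP (wt z1 + wt z2 + weight (fresh z1 I2)) 15.
  by exists I3; split; rewrite ?c3 //; clear -p1 p2 p3 wfy le15; lia.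
have wf1 := weight_le4 (fresh z1 I2); rewrite f1 in wf1.
have [sub12|] := boolP (fresh z1 I2 \subset nb z2).
  have f12 : fresh z2 I2 = fresh z1 I2.
    apply/esym/eqP; rewrite eqEcard f1 f2 andbT subsetD sub12 /=.
    by rewrite disjoint_sym disj_fresh.
  have := @expand_gain1 _ _ z2 (zF2 _ z1z) f10 (zF2 _ z2z).
  rewrite eq_sym nz f12 f10 subxx f1 => /(_ isT isT isT); rewrite -/I3 => p3'.
  by exists I3; split; rewrite ?c3 //; clear -p1 p2 p3' wfy w1 w2 wf1; lia.
case/subsetPn => c cf; rewrite in_nb => ecz2.
have [cR2 ez1c] : c \notin reach I2 /\ e z1 c.
  by move: cf; rewrite in_fresh => /andP.
have cR : c \notin reach I.
  by apply: contra cR2 => cR; rewrite R2 !in_setU cR !orbT.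
have cy : c != y by apply: contraNneq cR2 => ->; rewrite R2 !in_setU set11 orbT.
have wc : wt c = 4.
  have : weight (fresh z1 I2) <= wt c + 4.
    rewrite /weight (big_setD1 c) //= leq_add2l.
    apply: leq_trans (weight_le4 _) _.
    by move: f1; rewrite (cardsD1 c) cf; clear; lia.
  by move: (wt_le4 c); clear -gt15 w1 w2; lia.
have dc : 4 <= degree e c by rewrite wt_heavy // wc.
have [/exists_inP[x xR exc]|noadj] := boolP [exists x in reach I, e x c].
  have [xF1 xy fx1] := oldF _ _ xR cR cy exc.
  have xF2 : x \in fringe I2 by apply: fringe_keep.
  have xz1 : x != z1.
    by apply: contraTneq xR => ->; case: (zP _ z1z).
  have fx2 : fresh x I2 = [set c].
    rewrite fresh_expand // fx1 fy; apply/setP => u; rewrite !inE.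
    case: (eqVneq u c) => [->|_]; rewrite ?andbF ?andbT //.
    by move: cR2; rewrite R2 in_setU negb_or in_set2 => /andP[].
  have := expand_gain1 (zF2 _ z1z) f10 xF2 xz1.
  rewrite fx2 -card_gt0 cards1 sub1set cf f1 => /(_ isT isT).
  rewrite -/I3 => p3'; exists I3.
  split; rewrite // ?c3; first by clear; lia.
  by clear -p1 p2 p3' wfy w1 w2 wf1; lia.
have cF3 : c \in fringe I3 by apply: fringe_fresh => //; apply: zF2.
(* In the tree, [c] is adjacent at most to [z1] and to the other vertex that was
   attached to [z1]. *)
have fc : 1 < #|fresh c I3|.
  move: dc; rewrite (degree_split c (reach I3)).
  have : #|nb c :&: reach I3| <= 2; last by rewrite /fresh; clear; lia.
  have : nb c :&: reach I3 \subset z1 |: (fresh z1 I2 :\ c).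
    apply/subsetP => x /setIP[]; rewrite in_nb => ecx.
    rewrite reach_expand ?zF2 // R2 => /setUP[/setUP[/set2P[]|/setU1P[|]]|].
    - by move->; rewrite setU11.
    - by move=> xz; rewrite xz e_sym (negPf ecz2) in ecx.
    - move=> xy; have : c \in fresh y I1.
        by rewrite in_fresh -xy e_sym ecx R1 in_setU1 (negPf cy) (negPf cR).
      by rewrite fy => cz; move: cR2; rewrite R2 in_setU cz.
    - move=> xR; case/negP: noadj; apply/exists_inP; exists x => //.
      by rewrite e_sym.
    move=> xf; rewrite setU1r // in_setD1 xf andbT.
    by apply: contraTneq ecx => ->; rewrite e_irr.
  move/subset_leq_card/leq_trans; apply.
  rewrite (leq_trans (leq_card_setU _ _)) // cards1.
  by move: f1; rewrite (cardsD1 c) cf; clear; lia.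
exists (c |: I3); split; first exact: grownS.
  by rewrite card_expand // c3; clear; lia.
by move: (expand_gain2 cF3 fc); clear -p1 p2 p3 wfy w1 w2 wf1 fc; lia.
Qed.

Hypothesis e_con : connected e.

Lemma frontier I : reach I != setT ->
  exists v y, [/\ v \in reach I, y \notin reach I & e v y].
Proof.
move=> nR.
have [/exists_inP[v vR /existsP[y /andP[yR evy]]]|nofr] :=
    boolP [exists v in reach I, [exists y, (y \notin reach I) && e v y]].
  by exists v, y.
case/negP: nR; rewrite eqEsubset subsetT /=; apply/subsetP => z _.
have cl : closed e (reach I).
  apply: intro_closed; first exact: sym_connect_sym.
  move=> x y exy xR; apply: contraR nofr => yR.
  by apply/exists_inP; exists x => //; apply/existsP; exists y; rewrite yR.
have /forallP/(_ p)/forallP/(_ z) cpz := e_con.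
by rewrite -(closed_connect cl cpz) in_reach eqxx.
Qed.

(** In the tight case the kills are [m - 1] in number, where [m] counts the
neighbours of [y] in the tree.  For [y] of degree at least 4 and [m <= 2], the
vertex [y] has at least [4 - m] outside neighbours and is expanded as well. *)
Lemma grow_step I : grown I -> reach I != setT -> improvable I.
Proof.
move=> gI nR.
have [v /andP[vF fv]|tI] :=
    pickP [pred v | (v \in fringe I) && (1 < #|fresh v I|)].
  exists (v |: I); split; [exact: grownS | by rewrite card_expand |].
  by move: (expand_gain2 vF fv); clear -fv; lia.
have {}tI : tight I.
  by move=> x xF; move/negbT: (tI x); rewrite /= xF /= -leqNgt.
have [v [y [vR yR evy]]] := frontier nR.
have [vF fv] := tight_fresh tI vR yR evy.
pose I1 := v |: I; have gI1 : grown I1 by apply: grownS.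
have c1 : #|I1| = #|I|.+1 by apply: card_expand.
have fv1 : #|fresh v I| = 1 by rewrite fv cards1.
have wfv : weight (fresh v I) = wt y by rewrite fv weight1.
have fv0 : fresh v I != set0 by rewrite -card_gt0 fv1.
have R1 : reach I1 = y |: reach I by rewrite reach_expand // fv setUC.
have yF1 : y \in fringe I1 by apply: fringe_fresh; rewrite ?fv ?set11.
have fyE : fresh y I1 = nb y :\: reach I by apply: fresh_next.
have vN : v \in nb y :&: reach I by rewrite inE in_nb e_sym evy.
have dy := degree_split y (reach I).
rewrite -fyE (cardsD1 v (nb y :&: _)) vN in dy.
(* [D] is the set of leaves that die because [y] is attached to [v] instead. *)
pose D := (nb y :&: reach I) :\ v; rewrite -/D in dy.
have p1 : (pot I + 3 * #|D|%:Z <= pot I1 + (wt y)%:Z)%R.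
  have := @expand_gain I v D vF fv0; rewrite fv1 wfv -/I1.
  have DR : D \subset reach I := subset_trans (subsetDl _ _) (subsetIr _ _).
  suff sD : D \subset dead I1 :\: dead I.
    by move=> /(_ sD (fun=> DR)); clear; lia.
  apply/subsetP => x /setD1P[xv /setIP[]]; rewrite in_nb e_sym => exy xR.
  have [xF fx] := tight_fresh tI xR yR exy.
  rewrite in_setD !in_dead xF fringe_keep //= R1.
  apply/andP; split; last by rewrite setUC -subDset -/(fresh x I) fx.
  by rewrite -setD_eq0 -/(fresh x I) fx -card_gt0 cards1.
have [le1|gt1] := leqP (wt y) (3 * #|D|).
  by exists I1; split=> //; rewrite ?c1 //; clear -p1 le1; lia.
have [heavy|light] := leqP 4 (degree e y).
  have D1 : #|D| <= 1 by move: (wt_le4 y); clear -gt1; lia.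
  have f2 : 1 < #|fresh y I1| by clear -dy heavy D1; lia.
  exists (y |: I1); split; first exact: grownS.
    by rewrite card_expand // c1; clear; lia.
  by move: (expand_gain2 yF1 f2) (wt_le4 y); clear -p1 dy heavy D1; lia.
have D0 : #|D| = 0 by move: (wt_deg3 (light : _ <= 3)); clear -gt1; lia.
have nyI : nb y :&: reach I = [set v].
  apply/esym/eqP; rewrite eqEcard sub1set vN cards1 (cardsD1 v) vN.
  by rewrite -/D D0.
have [d3|] := eqVneq (degree e y) 3.
  exact: (@cubic_step I v y).
move=> n3; have d1 : degree e y == 1.
  move: gt1; rewrite /wt (negPf n3) orbF; case: eqP => // _.
  by rewrite (leqNgt 4) light.
have fy0 : #|fresh y I1| = 0 by move: dy; rewrite (eqP d1) D0; clear; lia.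
have npf : ~~ pendant_free by apply/forallPn; exists y; rewrite d1.
(* A pendant [y] is itself a new dead leaf. *)
exists I1; split=> //; first by rewrite c1.
have := @expand_gain I v [set y] vF fv0.
rewrite fv1 wfv cards1 -/I1 /wt d1 /= => gain.
suff: (pot I + 9 * 1%:Z + 3 * 1%:Z <= pot I1 + 9 + 3%:Z)%R by clear; lia.
apply: gain; last by rewrite (negPf npf).
have sy : nb y \subset reach I1 by rewrite -setD_eq0 -cards_eq0 fy0.
have yD : y \notin dead I by rewrite in_dead in_setD (negPf yR) andbF.
by rewrite sub1set in_setD yD in_dead yF1.
Qed.

(** The number of expanded vertices bounds the number of improvements. *)
Lemma saturate I : grown I ->
  exists J, [/\ grown J, reach J = setT & (pot I <= pot J)%R].
Proof.
have [n] := ubnP (#|T| - #|I|); elim: n I => // n IH I ltn gI.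
have [RI|nR] := eqVneq (reach I) setT; first by exists I.
have [J [gJ ltJ pJ]] := grow_step gI nR.
have cJ : #|J| <= #|T| := max_card _.
have [|K [gK RK pK]] := IH J _ gJ; first by clear -ltn ltJ cJ; lia.
by exists K; split=> //; apply: le_trans pJ pK.
Qed.

End Growth.

(** * Spanning trees from expansions *)

Section Trees.

Set Implicit Arguments.
Unset Strict Implicit.
Unset Printing Implicit Defensive.

Local Open Scope nat_scope.

Variables (T : finType) (e : rel T).
Hypotheses (e_sym : symmetric e) (e_irr : irreflexive e).
Implicit Types (S A : {set T}) (F : {set T * T}).

(** The tree lives on [S] but [adj F] is a relation on all of [T], so that the
vertices outside [S] are isolated and no change of type is needed to grow it. *)
Definition tree_on S F : Prop :=
  [/\ symmetric (adj F), subrel (adj F) e, forall x y, adj F x y -> x \in S,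
      {in S &, forall x y, connect (adj F) x y} & acyclic (adj F)].

Definition attach F x y : {set T * T} := [set (x, y); (y, x)] :|: F.

Lemma attachE F x y a b :
  adj (attach F x y) a b =
  [|| (a == x) && (b == y), (a == y) && (b == x) | adj F a b].
Proof. by rewrite /adj /= !inE !xpair_eqE orbA. Qed.

(** No cycle of length at least 3 passes through the new vertex [x]: its two
neighbours on the cycle would both be [y]. *)
Lemma attach_tree S F x y : tree_on S F -> y \in S -> x \notin S -> e y x ->
  tree_on (x |: S) (attach F x y).
Proof.
move=> [symF subF inF conF acF] yS xS eyx.
have symA : symmetric (adj (attach F x y)).
  by move=> a b; rewrite !attachE symF orbCA (andbC (b == x)) (andbC (b == y)).
have nFx b : adj F x b = false by apply/negP => /inF; rewrite (negPf xS).
have xA b : adj (attach F x y) x b -> b = y.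
  rewrite attachE nFx eqxx orbF /= => /orP[/eqP //|/andP[/eqP xy]].
  by move: xS; rewrite xy yS.
have subA : subrel (adj F) (adj (attach F x y)).
  by move=> a b ab; rewrite attachE ab !orbT.
split=> //.
- move=> a b; rewrite attachE.
  by case/or3P => [/andP[/eqP-> /eqP->]|/andP[/eqP-> /eqP->]|/subF] //; rewrite e_sym.
- move=> a b; rewrite attachE.
  by case/or3P => [/andP[/eqP-> _]|/andP[/eqP-> _]|/inF aS];
    rewrite ?setU11 ?setU1r.
- have toy a : a \in x |: S -> connect (adj (attach F x y)) a y.
    case/setU1P => [->|aS]; first by apply: connect1; rewrite attachE !eqxx.
    apply: connect_sub (conF _ _ aS yS) => u v uv.
    by apply: connect1; apply: subA.
  move=> a b /toy ay /toy byy; apply: connect_trans ay _.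
  by rewrite (sym_connect_sym symA).
apply/acyclicP => c c2 /andP[cyc uc]; have [xc|xc] := boolP (x \in c).
  case/rot_to: xc => i c' defc; move: cyc uc c2.
  rewrite -(rot_cycle i) -(rot_uniq i) -(size_rot i) defc.
  case: c' {defc} => [|a c'] //=; rewrite rcons_path.
  case/and3P => /xA -> _; rewrite symA => /xA.
  case: c' => [|b c'] //= lasty /andP[_ /andP[ny _]] _.
  by move: ny; rewrite -{1}lasty mem_last.
have /acyclicP/(_ _ c2) := acF; apply; rewrite /ucycle uc andbT.
have sub_off : {in [pred z | z != x] &, subrel (adj (attach F x y)) (adj F)}.
  move=> a b; rewrite !inE attachE => /negPf-> /negPf->.
  by rewrite andbF.
apply: (sub_in_cycle sub_off) cyc; apply/allP => z zc /=.
by apply: contraNneq xc => <-.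
Qed.

Lemma attach_degree_new S F x y : tree_on S F -> x \notin S ->
  degree (adj (attach F x y)) x <= 1.
Proof.
case=> _ _ inF _ _ xS; rewrite -(cards1 y); apply: subset_leq_card.
apply/subsetP => b; rewrite !inE attachE eqxx.
by case/or3P => [|/andP[/eqP<-]|/inF] //; rewrite (negPf xS).
Qed.

Lemma attach_degree_old F x y z : z != x -> z != y ->
  degree (adj (attach F x y)) z = degree (adj F) z.
Proof.
move=> /negPf zx /negPf zy; apply: eq_card => b.
by rewrite !inE attachE zx zy.
Qed.

Lemma attach_all S F v A : tree_on S F -> v \in S -> [disjoint S & A] ->
    (forall x, x \in A -> e v x) ->
  exists F', [/\ tree_on (S :|: A) F',
    forall x, x \in A -> degree (adj F') x <= 1 &
    forall x, x \notin A -> x != v -> degree (adj F') x = degree (adj F) x].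
Proof.
move=> tF vS; have [n] := ubnP #|A|; elim: n A => // n IH A leA dA evA.
have [->|[x xA]] := set_0Vmem A.
  by exists F; rewrite setU0; split=> // x; rewrite inE.
have xS : x \notin S by apply: contraL xA => xS; rewrite (disjointFr dA).
have sA : A :\ x \subset A := subsetDl _ _.
have [||y yA|F' [tF' newF' oldF']] := IH (A :\ x).
- by move: leA; rewrite (cardsD1 x) xA.
- exact: disjointWr dA.
- by apply: evA; apply: (subsetP sA).
have xS' : x \notin S :|: (A :\ x) by rewrite in_setU negb_or xS setD11.
have xv : x != v by apply: contraNneq xS => ->.
exists (attach F' x v); split.
- have -> : S :|: A = x |: (S :|: (A :\ x)) by rewrite setUCA setD1K.
  by apply: attach_tree; rewrite ?evA // inE vS.
- move=> z zA; have [->|zx] := eqVneq z x; first exact: attach_degree_new tF' _.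
  rewrite attach_degree_old ?newF' ?inE ?zx //.
  by apply: contraTneq zA => ->; rewrite (disjointFr dA).
move=> z zA zv; have zx : z != x by apply: contraNneq zA => ->.
by rewrite attach_degree_old // oldF' // inE (negPf zA) andbF.
Qed.

Lemma tree_on1 x : tree_on [set x] set0.
Proof.
have F0 a b : adj (set0 : {set T * T}) a b = false by rewrite /adj /= inE.
split; try by move=> a b; rewrite ?F0.
  by move=> a b /set1P-> /set1P->.
by apply/acyclicP => -[|a [|b c]] //= _; rewrite /ucycle /= F0.
Qed.

(** Expanding [v] changes no degree in the tree except those of [v] and of the
vertices attached to it. *)
Lemma grown_tree p I : grown e p I ->
  exists2 F, tree_on (reach e p I) F &
    forall x, x \in reach e p I -> x \notin I -> degree (adj F) x <= 1.
Proof.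
elim=> [|J v gJ [F tF lF] vF].
  rewrite reach0; exists set0 => [|x _ _]; first exact: tree_on1.
  by rewrite /degree eq_card0 // => y; rewrite !inE /adj /= inE.
have [vR vJ] := setDP vF.
have [|x|F' [tF' newF' oldF']] := attach_all (A := fresh e p v J) tF vR.
- exact: disj_fresh.
- by rewrite in_fresh => /andP[].
rewrite reach_expand //; exists F' => // x xR; rewrite in_setU1 negb_or.
case/andP => xv xJ; have [/newF' //|xf] := boolP (x \in fresh e p v J).
rewrite oldF' //; apply: lF => //.
by move: xR; rewrite in_setU (negPf xf) orbF.
Qed.

Lemma connected_degree_gt0 (r : rel T) x :
  connected r -> 1 < #|T| -> 0 < degree r x.
Proof.
move=> con T1; have [z zx] : exists z, z != x.
  have : 0 < #|predC1 x| by rewrite cardC1; lia.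
  by case/card_gt0P => z; exists z.
have /forallP/(_ x)/forallP/(_ z)/connectP[[|y q] /=] := con.
  by move=> _ zE; rewrite zE eqxx in zx.
by case/andP=> rxy _ _; apply/card_gt0P; exists y; rewrite inE.
Qed.

(** Pendant vertices of the graph are leaves of every spanning tree, even if they
have been expanded; this makes a pendant root count. *)
Lemma grown_leaves p I : 1 < #|T| -> grown e p I -> reach e p I = setT ->
  #|~: I :|: [set x | degree e x == 1]| <= max_leaves e.
Proof.
move=> T1 gI RI; have [F tF lF] := grown_tree gI; rewrite RI in tF lF.
case: tF => symF subF _ conF acF.
have con : connected (adj F).
  by apply/forallP => x; apply/forallP => y; apply: conF; rewrite inE.
have spF : spanning_tree e F.
  apply/and3P; split; last by rewrite /tree con.
    by apply/forallP => x; apply/forallP => y; rewrite symF.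
  by apply/forallP => x; apply/forallP => y; apply/implyP; apply: subF.
apply: leq_trans (leq_bigmax_cond _ spF); apply: subset_leq_card.
apply/subsetP => x xL; rewrite inE eqn_leq (connected_degree_gt0 _ con) // andbT.
case/setUP: xL => [|]; rewrite inE; first by apply: lF; rewrite inE.
move/eqP <-; apply: subset_leq_card; apply/subsetP => y.
by rewrite !inE; apply: subF.
Qed.

(** * The bound *)

Lemma max_leaves_bound : connected e -> 1 < #|T| ->
  weight e setT + 18 <= 12 * max_leaves e.
Proof.
move=> con T1; have deg0 x := connected_degree_gt0 x con T1.
have [pf|/forallPn[p]] := boolP (pendant_free e); last first.
  rewrite negbK => dp; have g0 : grown e p set0 by apply: grown0.
  have [I [gI RI pI]] := saturate e_sym e_irr con g0.
  (* A tree reduced to its root has [p] as its only leaf: [9 - 3]. *)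
  have pot0 : (6 <= pot e p set0)%R.
    rewrite /pot /bonus reach0 weight1 /fringe reach0 setD0 cards1.
    rewrite /wt dp /=; lia.
  have pI0 : p \in I.
    apply: (grown_root gI); apply: contra_eqN RI => /eqP->.
    by rewrite reach0; apply: contraTneq T1 => E; rewrite -cardsT -E cards1.
  have := grown_leaves T1 gI RI.
  have : #|p |: ~: I| <= #|~: I :|: [set x | degree e x == 1]|.
    by apply: subset_leq_card; rewrite setUC setUS // sub1set inE.
  rewrite cardsU1 inE pI0 /=; move: pI; rewrite (pot_spanning RI).
  by move: pot0; clear; lia.
have [p0 _] : exists x : T, true by case/card_gt0P: (ltnW T1) => x; exists x.
have [r _ max_r] := arg_maxnP (degree e) (isT : xpredT p0).
have maxr x : degree e x <= degree e r by apply: max_r.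
have gr : grown e r [set r].
  by rewrite -(setU0 [set r]); apply: grownS; [apply: grown0 | apply: root_fringe].
have [I [gI RI pI]] := saturate e_sym e_irr con gr.
have lI := leq_trans (subset_leq_card (subsetUl _ _)) (grown_leaves T1 gI RI).
suff: (18 <= pot e r [set r])%R.
  by move: pI lI; rewrite (pot_spanning RI); clear; lia.
have rF := root_fringe e r; have fr := fresh_root r e_irr.
have RE : reach e r [set r] = r |: nb e r.
  by rewrite -{1}(setU0 [set r]) reach_expand // reach0 fr.
have rN : r \notin nb e r by rewrite in_nb e_irr.
have FE : fringe e r [set r] = nb e r by rewrite /fringe RE setU1K.
(* The star at [r] either spans, with all of its leaves dead, or has the bonus. *)
have c1 : 1 <= #|dead e r [set r]| + bonus e r [set r].
  rewrite /bonus pf /=; have [RT|_] := eqVneq; last by rewrite addn1.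
  have -> : dead e r [set r] = nb e r.
    by apply/setP => x; rewrite in_dead FE RT subsetT andbT.
  by rewrite addn0 deg0.
have WE : weight e (reach e r [set r]) = wt e r + weight e (nb e r).
  by rewrite RE weightU ?weight1 // disjoints1.
have dr : #|nb e r| = degree e r by [].
rewrite /pot WE FE dr.
(* For [r] of degree [d >= 4] the star has at least [9 * d + 3 - 4 * (d + 1)];
   below, all weights are at most 3 for [d = 3], and 0 for [d = 2]. *)
have [heavy|light] := leqP 4 (degree e r).
  have := wt_le4 e r; have := weight_le4 e (nb e r); rewrite dr.
  by move: c1 heavy; clear; lia.
have d1 : degree e r != 1 by move/forallP: pf.
have [d3|n3] := eqVneq (degree e r) 3.
  have w3 : weight e (nb e r) <= \sum_(x in nb e r) 3.
    by apply: leq_sum => x _; apply: wt_deg3; rewrite -d3 maxr.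
  move: w3; rewrite sum_nat_const dr d3.
  by have := @wt_deg3 _ e r; rewrite d3 => /(_ isT); move: c1; clear; lia.
have d2 : degree e r = 2 by move: (deg0 r) light d1 n3; clear; lia.
have w0 x : wt e x = 0.
  have dx : degree e x <= 2 by rewrite -d2 maxr.
  have nx : degree e x != 1 by move/forallP: pf.
  rewrite /wt (negPf nx) /= ifN; last by move: dx; clear; lia.
  by rewrite ifN // -ltnNge; move: dx; clear; lia.
have -> : weight e (nb e r) = 0 by apply: big1 => x _; apply: w0.
by rewrite w0 d2; move: c1; clear; lia.
Qed.

End Trees.

Theorem theorem1 (T : finType) (e : rel T) (He : simple_graph e)
    (Hconn : connected e) (Hv : (1 < #|T|)%N) (s t : nat)
    (Hs : s = #|[set x : T | (degree e x == 1%N) || (degree e x == 3%N)]|)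
    (Ht : t = #|[set x : T | (4 <= degree e x)%N]|) :
  1 / 3 * t%:R + 1 / 4 * s%:R + 3 / 2 <= (max_leaves e)%:R :> rat.
Proof.
case: He => e_sym e_irr.
have := max_leaves_bound e_sym e_irr Hconn Hv.
rewrite weightT -Hs -Ht -(ler_nat rat) (natrD _ (_ + _)) natrD !natrM; lra.
Qed.
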